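(* Let $(G,p)$ be an $r$-dimensional framework on $n$ vertices in $\mathbb{R}^r$, $r \le n-2$, and let $\{k,l\} \in \overline{E}(G)$. Let $\Omega$ be a nonzero positive semidefinite stress matrix of $(G,p)$. Suppose that there does not exist $y=(y_{ij})_{\{i,j\}\in\overline{E}(G)}$ (a real vector indexed by the missing edges of $G$) with $y_{kl}\neq 0$ and $$\Omega\Big(\sum_{\{i,j\}\in\overline{E}(G)} y_{ij}E^{ij}\Big)=\mathbf{0}.$$ Then the pair $\{k,l\}$ is universally linked.
   Context: A (bar) framework $(G,p)$ in $\mathbb{R}^r$ is a simple graph $G$ on vertices $1,\dots,n$ together with points $p^1,\dots,p^n\in\mathbb{R}^r$ (vertex $i$ is placed at $p^i$). Throughout, $G$ is connected and not complete. $(G,p)$ is $r$-dimensional if $p^1,\dots,p^n$ affinely span $\mathbb{R}^r$. $E(G)$ is the edge set of $G$ and $\overline{E}(G)=\{\{i,j\}: i\ne j,\ \{i,j\}\notin E(G)\}$ is the set of missing edges. Two frameworks $(G,p)$ and $(G,q)$ (on the same graph, possibly in Euclidean spaces of different dimensions) are equivalent if $\|p^i-p^j\|=\|q^i-q^j\|$ for every $\{i,j\}\in E(G)$. A pair of non-adjacent vertices $\{i,j\}$ of $(G,p)$ is universally linked if $\|p^i-p^j\|=\|q^i-q^j\|$ in every framework $(G,q)$, in any dimension, that is equivalent to $(G,p)$. A stress of $(G,p)$ is a function $\omega:E(G)\to\mathbb{R}$ with $\sum_{j:\{i,j\}\in E(G)}\omega_{ij}(p^i-p^j)=\mathbf{0}$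 for all $i$. The associated stress matrix is the $n\times n$ symmetric matrix $\Omega$ with $\Omega_{ij}=-\omega_{ij}$ if $\{i,j\}\in E(G)$, $\Omega_{ij}=0$ if $\{i,j\}\in\overline{E}(G)$, and $\Omega_{ii}=\sum_{k:\{i,k\}\in E(G)}\omega_{ik}$. $E^{ij}$ is the $n\times n$ symmetric matrix with 1's in the $(i,j)$ and $(j,i)$ entries and 0's elsewhere. *)

(* Defs.v *)
From mathcomp Require Import all_boot all_order all_algebra.
From mathcomp Require Import reals.

Set Implicit Arguments.
Unset Strict Implicit.
Unset Printing Implicit Defensive.

Import Order.TTheory GRing.Theory Num.Theory.

Local Open Scope ring_scope.

Record sgraph (n : nat) := SGraph {
  adj :> rel 'I_n;
  adj_sym : symmetric adj;
  adj_irr : irreflexive adj }.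

Definition connected_graph n (G : sgraph n) : Prop :=
  forall i j, connect G i j.

Definition complete_graph n (G : sgraph n) : Prop :=
  forall i j, i != j -> G i j.

Definition edges n (G : sgraph n) : {set {set 'I_n}} :=
  [set [set ij.1; ij.2] | ij : 'I_n * 'I_n & G ij.1 ij.2].

Definition missing_edges n (G : sgraph n) : {set {set 'I_n}} :=
  [set [set ij.1; ij.2] |
    ij : 'I_n * 'I_n & (ij.1 != ij.2) && ([set ij.1; ij.2] \notin edges G)].

(* The norm MathComp-Analysis puts on row vectors is the max norm. *)
Definition enorm (R : realType) r (x : 'rV[R]_r) : R :=
  Num.sqrt (\sum_(i < r) x 0 i ^+ 2).

Definition affinely_spans (R : realType) n r (p : 'I_n -> 'rV[R]_r) : Prop :=
  forall x : 'rV[R]_r, exists a : 'I_n -> R,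
    \sum_i a i = 1 /\ x = \sum_i a i *: p i.

Definition equivalent_frameworks (R : realType) n (G : sgraph n) r s
    (p : 'I_n -> 'rV[R]_r) (q : 'I_n -> 'rV[R]_s) : Prop :=
  forall i j, [set i; j] \in edges G ->
    enorm (p i - p j) = enorm (q i - q j).

Definition universally_linked (R : realType) n (G : sgraph n) r
    (p : 'I_n -> 'rV[R]_r) (k l : 'I_n) : Prop :=
  forall (s : nat) (q : 'I_n -> 'rV[R]_s), equivalent_frameworks G p q ->
    enorm (p k - p l) = enorm (q k - q l).

(* Functions on E(G) or on the missing edges are total functions on
   {set 'I_n}; only their values on the relevant pairs are ever used. *)
Definition is_stress (R : realType) n (G : sgraph n) r
    (p : 'I_n -> 'rV[R]_r) (w : {set 'I_n} -> R) : Prop :=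
  forall i, \sum_(j | [set i; j] \in edges G) w [set i; j] *: (p i - p j) = 0.

Definition stress_matrix (R : realType) n (G : sgraph n)
    (w : {set 'I_n} -> R) : 'M[R]_n :=
  \matrix_(i, j)
    if i == j then \sum_(k | [set i; k] \in edges G) w [set i; k]
    else if [set i; j] \in edges G then - w [set i; j]
    else 0.

Definition is_stress_matrix (R : realType) n (G : sgraph n) r
    (p : 'I_n -> 'rV[R]_r) (Omega : 'M[R]_n) : Prop :=
  exists w, is_stress G p w /\ Omega = stress_matrix G w.

Definition possemidef (R : realType) n (A : 'M[R]_n) : Prop :=
  A^T = A /\ forall x : 'cV[R]_n, 0 <= (x^T *m A *m x) 0 0.

(* E^{ij} as a function of the unordered pair a = {i, j}, i != j: its (i', j')
   entry is 1 exactly when {i', j'} = a. *)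
Definition Emx (R : realType) n (a : {set 'I_n}) : 'M[R]_n :=
  \matrix_(i, j) ([set i; j] == a)%:R.

(* Main.v *)
Require Import Defs.
From mathcomp Require Import all_boot all_order all_algebra.
From mathcomp Require Import reals ring.

Set Implicit Arguments.
Unset Strict Implicit.
Unset Printing Implicit Defensive.

Import Order.TTheory GRing.Theory Num.Theory.

Local Open Scope ring_scope.

(* An equivalent framework q satisfies sum_c (col c q)^T Omega (col c q) = 0,
   as this is a combination of squared edge lengths which vanishes at p; since
   Omega is positive semidefinite, Omega annihilates q as well as p.  Expanding
   squared distances, Omega D is then of the form xi 1^T, where D is the
   difference of the squared distance matrices of p and q.  But D vanishes on
   edges and on the diagonal while Omega vanishes on missing edges, so Omega D
   has zero diagonal: xi = 0 and Omega D = 0.  As D is supported on the missing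
   edges, the hypothesis forces its (k, l) entry to be zero. *)

Lemma edge_neq n (G : sgraph n) i j : [set i; j] \in edges G -> i != j.
Proof.
case/imsetP=> -[a b] /=; rewrite inE /= => Gab eq_ij.
(* Cardinality tells a singleton from a genuine pair, so the endpoints need not be matched up in
   order. *)
have /eqP : #|[set i; j]| = #|[set a; b]| by rewrite eq_ij.
rewrite !cards2; case: (i =P j) => // _; case: (a =P b) => // ab.
by rewrite ab adj_irr in Gab.
Qed.

Lemma in_missing_edges n (G : sgraph n) i j :
  ([set i; j] \in missing_edges G) = (i != j) && ([set i; j] \notin edges G).
Proof.
apply/imsetP/idP => [[[a b] /=]|ijP]; last by exists (i, j); rewrite ?inE.
rewrite inE /= => /andP[ab abE] eq_ij; rewrite eq_ij abE andbT.
have /eqP : #|[set i; j]| = #|[set a; b]| by rewrite eq_ij.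
by rewrite !cards2 ab; case: (i != j).
Qed.

Definition sqnorm (R : realType) r (x : 'rV[R]_r) : R := \sum_(i < r) x 0 i ^+ 2.

Lemma sqnorm_ge0 (R : realType) r (x : 'rV[R]_r) : 0 <= sqnorm x.
Proof. by apply: sumr_ge0 => i _; exact: sqr_ge0. Qed.

Lemma sqnormN (R : realType) r (x : 'rV[R]_r) : sqnorm (- x) = sqnorm x.
Proof. by apply: eq_bigr => i _; rewrite mxE sqrrN. Qed.

Lemma sqnorm0 (R : realType) r : sqnorm (0 : 'rV[R]_r) = 0.
Proof. by apply: big1 => i _; rewrite mxE expr0n. Qed.

Lemma enorm_eqP (R : realType) r s (x : 'rV[R]_r) (y : 'rV[R]_s) :
  enorm x = enorm y <-> sqnorm x = sqnorm y.
Proof.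
split=> [/(congr1 (fun z => z ^+ 2))|xy]; last by congr Num.sqrt.
by rewrite /enorm !sqr_sqrtr ?sqnorm_ge0.
Qed.

Lemma equivalent_sqnorm (R : realType) n (G : sgraph n) r s
    (p : 'I_n -> 'rV[R]_r) (q : 'I_n -> 'rV[R]_s) i j :
  equivalent_frameworks G p q -> [set i; j] \in edges G ->
  sqnorm (p i - p j) = sqnorm (q i - q j).
Proof. by move=> pq ij; apply/enorm_eqP; exact: pq. Qed.

(** Polarization: [P *m P^T] is the Gram matrix of the points. *)
Lemma sqnormB_mx (R : realType) n r (p : 'I_n -> 'rV[R]_r) i j :
  let P := \matrix_a p a in
  sqnorm (p i - p j) = sqnorm (p i) + sqnorm (p j) - 2 * (P *m P^T) i j.
Proof.
rewrite /sqnorm [(_ *m _) i j]mxE mulr_sumr -sumrN -!big_split /=.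
by apply: eq_bigr => c _; rewrite !mxE; ring.
Qed.

(** With [z = A *m x], the form at [x - t *: z] is a quadratic in [t] without constant term and with
    linear coefficient [- 2 * N], where [N] is the squared length of [z]. Being nonnegative for
    every [t], it forces [N = 0]. *)
Lemma psd_form_eq0 (R : realType) n (A : 'M[R]_n) (x : 'cV[R]_n) :
  possemidef A -> (x^T *m A *m x) 0 0 = 0 -> A *m x = 0.
Proof.
case=> A_sym A_ge0 xAx0; pose z := A *m x.
pose d := (z^T *m A *m z) 0 0; pose N := (z^T *m z) 0 0.
have d_ge0 : 0 <= d by exact: A_ge0.
have NE : N = \sum_i z i 0 ^+ 2.
  by rewrite /N mxE; apply: eq_bigr => i _; rewrite mxE expr2.
have N_ge0 : 0 <= N by rewrite NE; apply: sumr_ge0 => i _; exact: sqr_ge0.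
have form t : ((x - t *: z)^T *m A *m (x - t *: z)) 0 0
    = - (2 * t * N) + t ^+ 2 * d.
  have zx : z^T *m A *m x = z^T *m z by rewrite -mulmxA.
  have xz : x^T *m A *m z = z^T *m z by rewrite /z trmx_mul A_sym.
  rewrite [(x - _)^T]linearB /= [(t *: z)^T]linearZ /= !mulmxBl !mulmxBr.
  rewrite -!scalemxAr -!scalemxAl zx xz.
  have entries (B C D E : 'M[R]_1) : (B - t *: C - (t *: D - t *: (t *: E))) 0 0
      = B 0 0 - t * C 0 0 - (t * D 0 0 - t * (t * E 0 0)) by rewrite !mxE.
  by rewrite entries xAx0 -/N -/d; ring.
have N0 : N = 0.
  have d1_gt0 : 0 < d + 1 by rewrite ltr_wpDl.
  have := A_ge0 (x - (d + 1)^-1 *: z); rewrite form => tN.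
  (* The minimizer would be [t = N / d]; [d + 1] replaces [d], which may be zero, and the value is
     still negative unless [N = 0]. *)
  have := A_ge0 (x - (N / (d + 1)) *: z); rewrite form.
  have -> : - (2 * (N / (d + 1)) * N) + (N / (d + 1)) ^+ 2 * d
      = - ((d + 2) * (N / (d + 1)) ^+ 2) by field; rewrite gt_eqF.
  rewrite oppr_ge0 pmulr_rle0; last by rewrite ltr_wpDl.
  move=> sq_le0; apply/eqP; have : (N / (d + 1)) ^+ 2 == 0.
    by rewrite eq_le sq_le0 sqr_ge0.
  by rewrite sqrf_eq0 mulf_eq0 invr_eq0 (gt_eqF d1_gt0) orbF.
apply/matrixP => i j; rewrite ord1 [RHS]mxE -/z; apply/eqP.
rewrite -sqrf_eq0; move/eqP: N0; rewrite NE psumr_eq0.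
  by move=> /allP/(_ i); rewrite mem_index_enum; apply.
by move=> a _; exact: sqr_ge0.
Qed.

(** The diagonal entry is the sum of the weights at [i], so each row sums to zero and acts on
    differences only, as in a weighted graph Laplacian. *)
Lemma mul_stress_matrix (R : realType) n (G : sgraph n) (w : {set 'I_n} -> R)
    m (X : 'M[R]_(n, m)) i c :
  (stress_matrix G w *m X) i c
  = \sum_(j | [set i; j] \in edges G) w [set i; j] * (X i c - X j c).
Proof.
have ii : [set i; i] \notin edges G by apply/negP => /edge_neq; rewrite eqxx.
rewrite mxE (bigD1 i) //= mxE eqxx mulr_suml.
rewrite [RHS]big_mkcond [RHS](bigD1 i) //= (negPf ii) add0r.
rewrite [X in X + _]big_mkcond [X in X + _](bigD1 i) //= (negPf ii) add0r.
rewrite -big_split /=.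
apply: eq_bigr => j ji; rewrite mxE eq_sym (negPf ji).
by case: ifP => _; ring.
Qed.

Lemma stress_matrix_energy (R : realType) n (G : sgraph n)
    (w : {set 'I_n} -> R) r (p : 'I_n -> 'rV[R]_r) :
  let P := \matrix_a p a in
  2 * \sum_c ((col c P)^T *m stress_matrix G w *m col c P) 0 0
  = \sum_i \sum_(j | [set i; j] \in edges G)
      w [set i; j] * sqnorm (p i - p j).
Proof.
move=> P.
have energyE : \sum_c ((col c P)^T *m stress_matrix G w *m col c P) 0 0
    = \sum_i \sum_(j | [set i; j] \in edges G)
        \sum_c w [set i; j] * (P i c * (P i c - P j c)).
  under [RHS]eq_bigr do rewrite exchange_big /=.
  rewrite [RHS]exchange_big; apply: eq_bigr => c _.
  rewrite -mulmxA mxE; apply: eq_bigr => i _.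
  rewrite mul_stress_matrix mulr_sumr; apply: eq_bigr => j _.
  by rewrite !mxE mulrCA.
(* One of the two copies of the energy is reindexed by exchanging [i] and [j]; then [x_i (x_i - x_j)
   + x_j (x_j - x_i) = (x_i - x_j)^2] in each coordinate. *)
rewrite mulr_natl mulr2n {2}energyE energyE.
under [X in _ + X = _]eq_bigr do rewrite big_mkcond.
rewrite [X in _ + X]exchange_big -big_split; apply: eq_bigr => i _ /=.
rewrite -big_mkcond /=.
under [X in _ + X]eq_bigl do rewrite setUC.
rewrite -big_split; apply: eq_bigr => j _ /=.
rewrite -big_split mulr_sumr; apply: eq_bigr => c _ /=.
by rewrite [[set j; i]]setUC !mxE; ring.
Qed.

Lemma stress_mulmx_eq0 (R : realType) n (G : sgraph n) r
    (p : 'I_n -> 'rV[R]_r) (w : {set 'I_n} -> R) :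
  is_stress G p w -> stress_matrix G w *m (\matrix_a p a) = 0.
Proof.
move=> w_stress; apply/matrixP => i c; rewrite mul_stress_matrix.
have /rowP/(_ c) := w_stress i; rewrite summxE [RHS]mxE => sum0.
by rewrite [RHS]mxE -[RHS]sum0; apply: eq_bigr => j _; rewrite !mxE.
Qed.

Lemma equivalent_stress_mulmx_eq0 (R : realType) n (G : sgraph n) r s
    (p : 'I_n -> 'rV[R]_r) (q : 'I_n -> 'rV[R]_s) (w : {set 'I_n} -> R) :
  is_stress G p w -> possemidef (stress_matrix G w) ->
  equivalent_frameworks G p q -> stress_matrix G w *m (\matrix_a q a) = 0.
Proof.
move=> w_stress psd pq; set Q := \matrix_a q a.
have /eqP : 2 * \sum_c ((col c Q)^T *m stress_matrix G w *m col c Q) 0 0 = 0.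
  rewrite stress_matrix_energy.
  under eq_bigr => i _ do under eq_bigr => j ij do
    rewrite -(equivalent_sqnorm pq ij).
  rewrite -stress_matrix_energy big1 ?mulr0 // => c _.
  rewrite -mulmxA {2}colE [_ *m (_ *m delta_mx _ _)]mulmxA.
  by rewrite stress_mulmx_eq0 // mul0mx mulmx0 mxE.
rewrite mulf_eq0 pnatr_eq0 /= psumr_eq0 => [/allP form0|c _]; last exact: psd.2.
apply/matrixP => i c; have /eqP := form0 c (mem_index_enum c).
move/(psd_form_eq0 psd); rewrite colE mulmxA -colE => /colP/(_ i).
by rewrite !mxE.
Qed.

Lemma stress_matrix_mul_missing (R : realType) n (G : sgraph n)
    (w : {set 'I_n} -> R) (D : 'M[R]_n) i :
  (forall j, D j j = 0) -> (forall j, [set i; j] \in edges G -> D j i = 0) ->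
  (stress_matrix G w *m D) i i = 0.
Proof.
move=> D0 DE; rewrite mul_stress_matrix big1 // => j ij.
by rewrite D0 DE // subrr mulr0.
Qed.

Definition sqdist_diff (R : realType) n r s
    (p : 'I_n -> 'rV[R]_r) (q : 'I_n -> 'rV[R]_s) : 'M[R]_n :=
  \matrix_(i, j) (sqnorm (p i - p j) - sqnorm (q i - q j)).

Lemma stress_mul_sqdist_diff (R : realType) n (G : sgraph n) r s
    (p : 'I_n -> 'rV[R]_r) (q : 'I_n -> 'rV[R]_s) (w : {set 'I_n} -> R) :
  is_stress G p w -> possemidef (stress_matrix G w) ->
  equivalent_frameworks G p q -> stress_matrix G w *m sqdist_diff p q = 0.
Proof.
move=> w_stress psd pq; set Omega := stress_matrix G w.
set D := sqdist_diff p q.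
have OP : Omega *m (\matrix_a p a) = 0 by exact: stress_mulmx_eq0.
have OQ : Omega *m (\matrix_a q a) = 0 by exact: equivalent_stress_mulmx_eq0 pq.
pose a : 'cV[R]_n := \col_i (sqnorm (p i) - sqnorm (q i)).
have O1 (b : 'rV[R]_n) : Omega *m (const_mx 1 *m b : 'M_n) = 0.
  apply/matrixP => i j; rewrite mulmxA mxE big_ord1 mul_stress_matrix.
  by rewrite big1 ?mul0r ?mxE // => m _; rewrite !mxE subrr mulr0.
(* The squared lengths of single points give the two rank-one terms, the inner products give the two
   Gram matrices. *)
have DE : D = a *m const_mx 1 + const_mx 1 *m a^T
    - 2 *: ((\matrix_a p a) *m (\matrix_a p a)^T)
    + 2 *: ((\matrix_a q a) *m (\matrix_a q a)^T).
  apply/matrixP => i j; rewrite [LHS]mxE !sqnormB_mx.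
  have entries (A B C E : 'M[R]_n) : (A + B - 2 *: C + 2 *: E) i j
      = A i j + B i j - 2 * C i j + 2 * E i j by rewrite !mxE.
  rewrite entries ![(_ *m const_mx 1) _ _]mxE ![(const_mx 1 *m _) _ _]mxE.
  by rewrite !big_ord1 !mxE; ring.
(* [Omega] kills the all-ones column and both configurations, so only [Omega *m a *m const_mx 1]
   survives, whose columns are all equal. *)
have row_const i j j' : (Omega *m D) i j = (Omega *m D) i j'.
  rewrite DE mulmxDr mulmxBr mulmxDr O1 -!scalemxAr !mulmxA OP OQ !mul0mx.
  rewrite !scaler0 subr0 !addr0 !mxE !big_ord1.
  by rewrite !mxE.
apply/matrixP => i j; rewrite (row_const i j i) stress_matrix_mul_missing ?mxE //.
  by move=> m; rewrite mxE !subrr !sqnorm0 subrr.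
by move=> m; rewrite setUC mxE => mi; rewrite (equivalent_sqnorm pq mi) subrr.
Qed.

(** Different pairs [a] give matrices [Emx R a] with disjoint supports, so at most one term reaches
    a given entry. *)
Lemma sum_Emx (R : realType) n (S : {set {set 'I_n}}) (y : {set 'I_n} -> R) i j :
  (\sum_(a in S) y a *: Emx R a) i j
  = if [set i; j] \in S then y [set i; j] else 0.
Proof.
rewrite summxE; under eq_bigr do rewrite !mxE.
case: ifP => ijS; last first.
  apply: big1 => a aS; case: eqP => [ija|_]; last by rewrite mulr0.
  by rewrite ija aS in ijS.
rewrite (bigD1 [set i; j]) //= eqxx mulr1 big1 ?addr0 // => a /andP[_ aij].
by rewrite eq_sym (negPf aij) mulr0.
Qed.

Theorem theorem3 (R : realType) (n r : nat) (G : sgraph n)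
    (p : 'I_n -> 'rV[R]_r) (k l : 'I_n) (Omega : 'M[R]_n)
    (G_connected : connected_graph G)
    (G_not_complete : ~ complete_graph G)
    (p_dim : affinely_spans p)
    (le_r_n : (r + 2 <= n)%N)
    (kl_missing : [set k; l] \in missing_edges G)
    (Omega_stress : is_stress_matrix G p Omega)
    (Omega_neq0 : Omega != 0)
    (Omega_psd : possemidef Omega)
    (no_y : ~ exists y : {set 'I_n} -> R,
        y [set k; l] != 0 /\
        Omega *m (\sum_(a in missing_edges G) y a *: Emx R a) = 0) :
  universally_linked G p k l.
Proof.
case: Omega_stress => w [w_stress OmegaE]; subst Omega => s q pq.
have [<-|kl] := eqVneq k l; first by apply/enorm_eqP; rewrite !subrr !sqnorm0.
apply/enorm_eqP/eqP/negP => dist_neq; apply: no_y.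
pose D := sqdist_diff p q.
have D0 i : D i i = 0 by rewrite mxE !subrr !sqnorm0 subrr.
have DC i j : D i j = D j i.
  by rewrite !mxE -[p i - p j]opprB -[q i - q j]opprB !sqnormN.
have DE i j : [set i; j] \in edges G -> D i j = 0.
  by move=> ij; rewrite mxE (equivalent_sqnorm pq ij) subrr.
(* Summing over ordered pairs defines y on unordered pairs without choosing
   an orientation; it counts each entry of D twice. *)
pose y (a : {set 'I_n}) := \sum_(i in a) \sum_(j in a) D i j.
have yE i j : i != j -> y [set i; j] = 2 * D i j.
  move=> ij; rewrite /y big_setU1 ?inE //= big_set1 !big_setU1 ?inE //=.
  by rewrite !big_set1 !D0 (DC j i); ring.
exists y; split.
  rewrite yE // mulf_eq0 pnatr_eq0 /= mxE subr_eq0; exact/negP.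
(* The sum is zero on the diagonal and on the edges, where [D] vanishes as well; on missing edges
   [yE] gives the entry. *)
have -> : \sum_(a in missing_edges G) y a *: Emx R a = 2 *: D.
  apply/matrixP => i j; rewrite sum_Emx [RHS]mxE in_missing_edges.
  have [<-|ij] /= := eqVneq i j; first by rewrite D0 mulr0.
  by have [/DE ->|_] /= := boolP (_ \in _); rewrite ?mulr0 // yE.
by rewrite -scalemxAr (stress_mul_sqdist_diff w_stress Omega_psd pq) scaler0.
Qed.
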